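(* Let $G$ be an MP-tree and let $M_G$ be its multipath matroid, with rank function $r$. Then for every non-negative integer $k$, $$k\,T_{M_G}(1-k,0)=(-1)^{r(E(G))}\,\tau_G(k).$$
   Context: Digraphs: finite, at most one edge $(v,w)$ from $v$ to $w$ for distinct $v,w$. A multipath is a spanning subgraph each of whose connected components is a vertex or a simple path (sequence of non-loop edges with target of each = source of next, no repeated vertex, not closing into a cycle); $\mathrm{Mult}(G)$ is the set of multipaths (as edge sets); $M_G=(E(G),\mathrm{Mult}(G))$. An MP-digraph satisfies (MP1) no subgraph isomorphic to $D_A$ (vertices $v_0,v_1,v_2$, edges $(v_1,v_0),(v_0,v_2),(v_1,v_2)$) or $D_B$ (vertices $v_0,\dots,v_3$, edges $(v_0,v_1),(v_2,v_1),(v_2,v_3)$) or their edge-reversals, and (MP2) every coherently oriented cycle of length $\ge2$ is a connected component; then $M_G$ is a matroid, with rank $r(A)$ the largest size of a multipath inside $A$. An MP-tree is an MP-digraph whose underlying undirected graph is a tree. Tutte polynomial: $T_M(x,y)=\sum_{A\subseteq X}(x-1)^{r(X)-r(A)}(y-1)^{|A|-r(A)}$. A flowing $k$-colouring of a digraph $H$ is a map $c:V(H)\to\{1,\dots,k\}$ with $c(v)\neq c(w)$ for each edge $(v,w)$, $c(v)=c(v')$ whenever $(v,w),(v',w)$ are edges, and $c(v)=c(v')$ whenever $(w,v),(w,v')$ are edges; $\tau_H(k)$ is the number of flowing $k$-colourings. *)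

(* Defs.v *)
From HB Require Import structures.
From mathcomp Require Import all_boot all_order all_algebra.
Set Implicit Arguments.
Unset Strict Implicit.
Unset Printing Implicit Defensive.
Import GRing.Theory.
Local Open Scope ring_scope.

(* Loops are not excluded here; the tree condition below forbids them. *)
Record digraph := Digraph { vert :> finType; edge : rel vert }.

Definition edges (G : digraph) : {set G * G} := [set a | edge a.1 a.2].

Definition reverse (G : digraph) : digraph :=
  @Digraph G (fun v w : G => edge w v).

(* H is isomorphic to a (not necessarily induced) subgraph of G. *)
Definition contains (G H : digraph) : Prop :=
  exists f : H -> G,
    injective f /\ (forall v w : H, edge v w -> edge (f v) (f w)).

Definition digraph_of_seq (n : nat) (s : seq (nat * nat)) : digraph :=
  @Digraph 'I_n (fun i j : 'I_n => (val i, val j) \in s).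

Definition D_A : digraph := digraph_of_seq 3 [:: (1, 0); (0, 2); (1, 2)]%N.
Definition D_B : digraph := digraph_of_seq 4 [:: (0, 1); (2, 1); (2, 3)]%N.

(* Adjacency in the undirected simple graph underlying (V, A). *)
Definition uadj (V : finType) (A : {set V * V}) : rel V :=
  fun v w => ((v, w) \in A) || ((w, v) \in A).

Definition component (V : finType) (A : {set V * V}) (v : V) : {set V} :=
  [set w | connect (uadj A) v w].

Definition component_edges (V : finType) (A : {set V * V}) (v : V) :
  {set V * V} := [set a in A | a.1 \in component A v].

(* The component of v in (V, A) is a single vertex or a simple path: its
   vertices can be listed without repetition so that its edges are exactly
   the pairs of consecutive vertices (a one-element list has none). *)
Definition path_component (V : finType) (A : {set V * V}) (v : V) : bool :=
  has (fun s : seq V => component_edges A v == [set a in zip s (behead s)])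
      (permutations (enum (component A v))).

Definition multipath (G : digraph) (A : {set G * G}) : bool :=
  (A \subset edges G) && [forall v : G, path_component A v].

Record set_system (T : finType) :=
  SetSystem { ground : {set T}; indep : {set {set T}} }.

Definition multipath_matroid (G : digraph) : set_system (G * G)%type :=
  SetSystem (edges G) [set A | multipath A].

Definition rank (T : finType) (M : set_system T) (A : {set T}) : nat :=
  \max_(I in indep M | I \subset A) #|I|.

(* A polynomial in y with coefficients in Z[x]: x is ('X)%:P, y is 'X. *)
Definition tutte (T : finType) (M : set_system T) : {poly {poly int}} :=
  \sum_(A in powerset (ground M))
    (('X)%:P - 1) ^+ (rank M (ground M) - rank M A)
    * ('X - 1) ^+ (#|A| - rank M A).

Definition tutte_eval (T : finType) (M : set_system T) (x y : int) : int :=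
  (tutte M).[y%:P].[x].

Definition MP1 (G : digraph) : Prop :=
  [/\ ~ contains G D_A, ~ contains G (reverse D_A),
      ~ contains G D_B & ~ contains G (reverse D_B)].

(* The vertices of a coherently oriented cycle, in cyclic order, form s;
   zip s (rot 1 s) lists its edges. *)
Definition MP2 (G : digraph) : Prop :=
  forall s : seq G, (2 <= size s)%N -> uniq s -> cycle (@edge G) s ->
  forall v : G, v \in s ->
    component (edges G) v = [set w in s] /\
    component_edges (edges G) v = [set a in zip s (rot 1 s)].

Definition MP_digraph (G : digraph) : Prop := MP1 G /\ MP2 G.

Definition utree (V : finType) (u : rel V) : Prop :=
  [/\ (0 < #|V|)%N, irreflexive u, (forall v w : V, connect u v w)
    & forall s : seq V, (3 <= size s)%N -> uniq s -> ~~ cycle u s].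

Definition MP_tree (G : digraph) : Prop :=
  MP_digraph G /\ utree (uadj (edges G)).

Definition flowing (G : digraph) (k : nat) (c : {ffun G -> 'I_k}) : bool :=
  [&& [forall v : G, forall w : G, edge v w ==> (c v != c w)],
      [forall v : G, forall v' : G, forall w : G,
         edge v w && edge v' w ==> (c v == c v')]
    & [forall v : G, forall v' : G, forall w : G,
         edge w v && edge w v' ==> (c v == c v')]].

Definition tau (G : digraph) (k : nat) : nat :=
  #|[set c : {ffun G -> 'I_k} | flowing c]|.

(* Main.v *)
Require Import Defs.
From mathcomp Require Import all_boot all_order all_algebra.
Import GRing.Theory.
Local Open Scope ring_scope.

(* In an MP-tree, "equal source or equal target" is an equivalence relation on
   the edges (a failure of transitivity would produce a copy of D_B), and an
   edge set is a multipath iff it meets every class at most once. So M_G is a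
   partition matroid with c classes and T(x, 0) = x^c. On the other side, a
   flowing colouring with colours in Z/k is a vertex potential whose increments
   along edges are nonzero and depend only on the class; on a tree such
   potentials correspond to a root colour and a free choice of the c increments,
   so tau(k) = k (k - 1)^c. *)

(** * Partition matroids and their Tutte polynomial at y = 0 *)

(** Grouping the subsets by cardinality turns this into the binomial theorem. *)
Lemma sum_subsets_expr (R : comNzRingType) (T : finType) (Y : {set T})
    (a b : R) :
  \sum_(D : {set T} | D \subset Y) a ^+ #|D| * b ^+ (#|Y| - #|D|)
  = (a + b) ^+ #|Y|.
Proof.
rewrite addrC exprDn (partition_big (fun D : {set T} => inord #|D| : 'I_#|Y|.+1)
  xpredT) //=.
apply: eq_bigr => i _.
rewrite (eq_bigr (fun=> b ^+ (#|Y| - i) * a ^+ i)); last first.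
  move=> D /andP[sDY /eqP <-].
  by rewrite inordK ?ltnS ?subset_leq_card // mulrC.
rewrite sumr_const -(cards_draws Y i); congr (_ *+ _).
rewrite -cardsE; apply: eq_card => D; rewrite !inE unfold_in.
case sDY: (D \subset Y) => //=.
by rewrite -(inj_eq val_inj) /= inordK ?ltnS ?subset_leq_card.
Qed.

Lemma sum_subsets_sign (R : comNzRingType) (T : finType) (Y : {set T}) :
  \sum_(D : {set T} | D \subset Y) (-1) ^+ #|D| = (Y == set0)%:R :> R.
Proof.
have := sum_subsets_expr R T Y (-1) 1; rewrite addNr expr0n cards_eq0 => <-.
by apply: eq_bigr => D _; rewrite expr1n mulr1.
Qed.

(** An independent subset of [A] injects into [f @: A], and choosing one element in each fibre of
    [f] on [A] attains this bound. *)
Lemma rank_partition (T T' : finType) (M : set_system T) (f : T -> T')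
    (A : {set T}) :
  (forall I : {set T}, I \in indep M <->
     I \subset ground M /\ {in I &, injective f}) ->
  A \subset ground M -> rank M A = #|f @: A|.
Proof.
move=> indepM sAX; apply/eqP; rewrite eqn_leq; apply/andP; split.
  apply/bigmax_leqP => I /andP[/indepM[_ injI] sIA].
  by rewrite -(card_in_imset injI) subset_leq_card // imsetS.
(* The result of [pick] depends only on [f a], so [I] keeps exactly one element of each fibre. *)
pose I := [set a in A | [pick b in A | f b == f a] == Some a].
have pickE a b : f a = f b ->
    [pick c in A | f c == f a] = [pick c in A | f c == f b] by move=> ->.
have injI : {in I &, injective f}.
  move=> a b; rewrite !inE => /andP[_ /eqP pa] /andP[_ /eqP pb] fab.
  by move: pb; rewrite -(pickE _ _ fab) pa => -[].
have sIA : I \subset A by apply/subsetP => a; rewrite inE => /andP[].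
have -> : f @: A = f @: I.
  apply/eqP; rewrite eqEsubset (imsetS _ sIA) andbT.
  apply/subsetP => _ /imsetP[a aA ->].
  case E: [pick b in A | f b == f a] => [b|]; last first.
    by move: E; case: pickP => // /(_ a); rewrite aA eqxx.
  have [bA /eqP fb] : b \in A /\ f b == f a.
    by move: E; case: pickP => // c /andP[cA fc] [<-].
  by rewrite -fb imset_f // inE bA (pickE _ _ fb) E eqxx.
rewrite (card_in_imset injI).
apply: (leq_bigmax_cond (F := fun I0 : {set T} => #|I0|)).
by rewrite sIA andbT; apply/indepM; split=> //; apply: subset_trans sIA sAX.
Qed.

(** Such a matroid is a direct sum of rank-one uniform matroids, one per fibre. On m elements the
    summand has Tutte polynomial x + y + ... + y^(m-1), which is x at y = 0. *)
Lemma tutte_eval_partition (T T' : finType) (M : set_system T) (f : T -> T')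
    (x : int) :
  (forall I : {set T}, I \in indep M <->
     I \subset ground M /\ {in I &, injective f}) ->
  tutte_eval M x 0 = x ^+ #|f @: ground M|.
Proof.
move=> indepM; pose X := ground M; pose n := #|f @: X|.
rewrite /tutte_eval /tutte !horner_sum -/X.
(* Expand (x - 1)^(n - #|f A|) over the sets D of classes missed by A; after
   exchanging the sums, the signs (-1)^#|A| cancel unless D is everything. *)
have term A : A \in powerset X ->
   ((('X%:P - 1) ^+ (rank M X - rank M A)
      * ('X - 1) ^+ (#|A| - rank M A) : {poly {poly int}}).[0%:P]).[x]
   = \sum_(D : {set T'} | (D \subset f @: X) && (A \subset X :\: f @^-1: D))
       x ^+ #|D| * (-1) ^+ (n - #|D|) * (-1) ^+ #|A|.
  rewrite powersetE => sAX.
  rewrite !(hornerE, horner_exp) /=.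
  rewrite !(rank_partition _ _ _ f) // -/n.
  have lfA : (#|f @: A| <= #|A|)%N by apply: leq_imset_card.
  have sfA : f @: A \subset f @: X by apply: imsetS.
  have cD : #|f @: X :\: f @: A| = (n - #|f @: A|)%N.
    by rewrite cardsD (setIidPr sfA).
  rewrite -cD -sum_subsets_expr mulr_suml.
  apply: eq_big => [D|D].
    rewrite subsetD subsetD sAX /=; congr (_ && _).
    rewrite -!setI_eq0; apply/eqP/eqP => /setP E; apply/setP => z.
      rewrite !inE; apply/negP => /andP[zA fzD].
      by move: (E (f z)); rewrite !inE fzD imset_f.
    rewrite !inE; apply/negP => /andP[zD /imsetP[a aA za]].
    by move: (E a); rewrite !inE aA -za zD.
  move=> sD; rewrite -!mulrA; congr (_ * _).
  (* With [lfA], these bounds make the natural subtractions exact, so the signs can be compared by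
     parity. *)
  have lD : (#|D| <= n - #|f @: A|)%N by rewrite -cD subset_leq_card.
  have ln : (#|f @: A| <= n)%N by rewrite subset_leq_card.
  rewrite cD -!exprD -signr_odd -[RHS]signr_odd; congr (_ ^+ nat_of_bool _).
  rewrite !oddD !oddB //; last exact: leq_trans lD (leq_subr _ _).
  by case: (odd n); case: (odd #|D|); case: (odd #|A|); case: (odd #|_ @: _|).
rewrite (eq_bigr _ term).
rewrite (exchange_big_dep (fun D : {set T'} => D \subset f @: X)) /=;
  last by move=> A D _ /andP[].
rewrite (bigD1 (f @: X)) //= [X in _ + X]big1 ?addr0; last first.
  move=> D /andP[sD neD]; rewrite -mulr_sumr.
  rewrite (eq_bigl (fun A : {set T} => A \subset X :\: f @^-1: D)); last first.
    move=> A; rewrite powersetE sD /= andb_idl // => sA.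
    exact: subset_trans sA (subsetDl _ _).
  rewrite sum_subsets_sign.
  suff /negPf -> : X :\: f @^-1: D != set0 by rewrite mulr0.
  apply: contra neD; rewrite setD_eq0 => /subsetP sX.
  rewrite eqEsubset sD; apply/subsetP => _ /imsetP[a aX ->].
  by move: (sX a aX); rewrite inE.
rewrite (big_pred1 set0) => [|A]; first by rewrite subnn cards0 !mulr1.
rewrite powersetE subxx /=.
suff -> : X :\: f @^-1: (f @: X) = set0.
  by rewrite subset0 andb_idl // => /eqP ->; rewrite sub0set.
apply/eqP; rewrite setD_eq0; apply/subsetP => a aX.
by rewrite inE imset_f.
Qed.

(** * Potentials on trees *)

Lemma connect_exit (T : finType) (e : rel T) (S : {set T}) (x y : T) :
  connect e x y -> x \in S -> y \notin S ->
  exists s t, [/\ s \in S, t \notin S & e s t].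
Proof.
move=> /connectP[p pth ->]; elim: p x pth => [|z p IH] x /=.
  by move=> _ ->.
move=> /andP[exz pth] xS; have [zS|zS] := boolP (z \in S); first exact: IH.
by move=> _; exists x, z.
Qed.

Definition restrict_rel {T : finType} (e : rel T) (S : {set T}) : rel T :=
  fun x y => [&& e x y, x \in S & y \in S].

Lemma path_restrict (T : finType) (e : rel T) (S : {set T}) (x : T) p :
  path (restrict_rel e S) x p -> path e x p /\ {subset p <= S}.
Proof.
elim: p x => [|y p IH] x //= /andP[/and3P[exy _ yS] /IH[-> sp]].
by rewrite exy; split=> // z; rewrite inE => /predU1P[->|/sp].
Qed.

(** If [s] and [s'] differed, a simple path between them inside [S] would close up to a cycle
    through [t]. *)
Lemma tree_one_neighbour (V : finType) (u : rel V) (S : {set V}) (s s' t : V) :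
  symmetric u -> utree u -> t \notin S ->
  s \in S -> connect (restrict_rel u S) s s' -> u s t -> u s' t -> s = s'.
Proof.
move=> usym [_ _ _ acyc] tS sS /connectP[p0 pth0 ->].
case: (shortenP pth0) => p /path_restrict[pth pS] up _ ust.
case: p => [|y p] // in pth pS up * => ust'.
have ut : uniq [:: t, s, y & p].
  rewrite cons_uniq up andbT; apply: contra tS.
  by rewrite inE => /predU1P[->//|/pS].
case/negP: (acyc [:: t, s, y & p] isT ut).
by move: pth; rewrite /= rcons_path ust' (usym t) ust => /andP[-> ->].
Qed.

(** The domain grows from [r] one vertex at a time. Each new vertex has a single neighbour in the
    connected part already reached, so [g] dictates its value and no consistency condition
    arises. *)
Lemma tree_potential (V : finType) (Z : zmodType) (u : rel V)
    (g : V -> V -> Z) (r : V) (z : Z) :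
  symmetric u -> utree u -> (forall v w, u v w -> g w v = - g v w) ->
  exists c : V -> Z, c r = z /\ forall v w, u v w -> c w - c v = g v w.
Proof.
move=> usym tree ganti; have [V0 uirr conn acyc] := tree.
(* The invariant includes connectedness of [S] within itself, which [tree_one_neighbour] needs. *)
have grow n : (n < #|V|)%N -> exists (S : {set V}) (c : V -> Z),
    [/\ #|S| = n.+1, r \in S, {in S, forall v, connect (restrict_rel u S) r v},
        c r = z & {in S &, forall v w, u v w -> c w - c v = g v w}].
  elim: n => [|n IH] ltn.
    exists [set r], (fun=> z); split; rewrite ?cards1 ?set11 //.
      by move=> v /set1P->.
    by move=> v w /set1P-> /set1P->; rewrite uirr.
  have [S [c [cS rS conS cr pot]]] := IH (ltnW ltn).
  have [t0 t0S] : exists t0, t0 \notin S.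
    apply/existsP; rewrite -negb_forall; apply/negP => /forallP aS.
    have ST : S = setT by apply/setP => v; rewrite inE aS.
    by move: ltn; rewrite -cS ST cardsT ltnn.
  have [s [t [sS tS ust]]] := connect_exit _ _ _ _ _ (conn r t0) rS t0S.
  have nt v : v \in S -> v == t = false.
    by move=> vS; apply: contraNF tS => /eqP <-.
  have only v : v \in S -> u v t -> v = s.
    move=> vS uvt; apply/esym.
    apply: (tree_one_neighbour _ _ S s v t) => //.
    have sym : symmetric (restrict_rel u S).
      by move=> a b; rewrite /restrict_rel usym [X in _ && X]andbC.
    apply: connect_trans (conS v vS).
    by rewrite (sym_connect_sym sym) conS.
  have sub : subrel (restrict_rel u S) (restrict_rel u (t |: S)).
    by move=> a b /and3P[uab aS bS]; rewrite /restrict_rel uab !inE aS bS !orbT.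
  exists (t |: S), (fun v => if v == t then c s + g s t else c v); split.
  - by rewrite cardsU1 tS cS.
  - by rewrite !inE rS orbT.
  - have con v : v \in S -> connect (restrict_rel u (t |: S)) r v.
      move=> vS; apply: connect_sub (conS v vS) => a b /sub; exact: connect1.
    move=> v /setU1P[->|/con//]; apply: connect_trans (con s sS) _.
    by apply: connect1; rewrite /restrict_rel ust !inE sS eqxx !orbT.
  - by rewrite nt.
  - move=> v w /setU1P[->|vS] /setU1P[->|wS].
    + by rewrite uirr.
    + rewrite eqxx (nt _ wS) usym => utw; rewrite (only _ wS utw) (ganti _ _ ust).
      by rewrite opprD addrA subrr add0r.
    + rewrite eqxx (nt _ vS) => utv; rewrite (only _ vS utv).
      by rewrite addrC addKr.
    + by rewrite !nt //; apply: pot.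
have [|S [c [cS _ _ cr pot]]] := grow #|V|.-1; first by rewrite prednK.
exists c; split=> // v w; apply: pot.
all: suff -> : S = setT by rewrite inE.
all: by apply/eqP; rewrite eqEcard subsetT cardsT cS prednK /=.
Qed.

Lemma potential_unique (V : finType) (Z : zmodType) (u : rel V)
    (c1 c2 : V -> Z) (r : V) :
  (forall v, connect u r v) -> c1 r = c2 r ->
  (forall v w, u v w -> c1 w - c1 v = c2 w - c2 v) -> c1 =1 c2.
Proof.
move=> conn + dif v; have /connectP[p pth ->] := conn v.
elim: p r pth {conn} => [|w p IH] r //= /andP[urw pth] cr.
by apply: IH => //; have := dif _ _ urw; rewrite cr => /addIr.
Qed.

(** * Path components from longest directed paths *)

Lemma mem_zip_behead (T : eqType) (x0 : T) (s : seq T) (a : T * T) :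
  reflect (exists2 i, (i.+1 < size s)%N & a = (nth x0 s i, nth x0 s i.+1))
          (a \in zip s (behead s)).
Proof.
have sz : size (zip s (behead s)) = (size s).-1.
  by rewrite size_zip size_behead; apply/minn_idPr; case: (size s).
have lt i : (i < (size s).-1)%N = (i.+1 < size s)%N by case: (size s).
apply: (iffP (nthP (x0, x0))) => -[i].
  by rewrite sz => li <-; exists i; rewrite -?lt // nth_zip_cond sz li nth_behead.
move=> li ->; exists i; first by rewrite sz lt.
by rewrite nth_zip_cond sz lt li nth_behead.
Qed.

Lemma maximal_directed_path (V : finType) (e : rel V) (v : V) :
  exists s : seq V, [/\ uniq s, sorted e s, v \in s &
    forall t, uniq t -> sorted e t -> v \in t -> (size t <= size s)%N].
Proof.
pose P n := [exists t : n.-tuple V, [&& uniq t, sorted e t & v \in (t : seq V)]].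
have P1 : exists n, P n.
  exists 1%N; apply/existsP; exists [tuple v]; by rewrite /= mem_head.
have Pb n : P n -> (n <= #|V|)%N.
  move=> /existsP[t /and3P[ut _ _]].
  by rewrite -(size_tuple t) -(card_uniqP ut) max_card.
case: (ex_maxnP P1 Pb) => n /existsP[t /and3P[ut st vt]] mx.
exists t; split=> // t' ut' st' vt'; rewrite size_tuple; apply: mx.
by apply/existsP; exists (in_tuple t'); rewrite /= ut' st' vt'.
Qed.

Lemma uadj_sym (V : finType) (A : {set V * V}) : symmetric (uadj A).
Proof. by move=> v w; rewrite /uadj orbC. Qed.

(** A longest directed path through [v] is closed under successors and predecessors, hence is the
    whole component. The condition [s != [::]] is there because [cycle] holds of the empty
    sequence. *)
Lemma path_component_linear (V : finType) (A : {set V * V}) (v : V) :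
  (forall x y z, (x, y) \in A -> (x, z) \in A -> y = z) ->
  (forall x y z, (y, x) \in A -> (z, x) \in A -> y = z) ->
  (forall s : seq V, s != [::] -> uniq s ->
     ~~ cycle (fun x y => (x, y) \in A) s) ->
  path_component A v.
Proof.
move=> outA inA acyc; pose e x y := (x, y) \in A.
have [s [us ss vs mx]] := maximal_directed_path V e v.
have step i : (i.+1 < size s)%N -> (nth v s i, nth v s i.+1) \in A.
  by apply: (sortedP (e := e)).
have succ x y : x \in s -> (x, y) \in A -> (x, y) \in zip s (behead s).
  move=> xs xy; apply/(mem_zip_behead _ v).
  have li : (index x s < size s)%N by rewrite index_mem.
  have xE : nth v s (index x s) = x by rewrite nth_index.
  have [lt|ge] := ltnP (index x s).+1 (size s).
    exists (index x s) => //; rewrite xE; congr (_, _).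
    by apply: (outA x) => //; rewrite -[X in (X, _)]xE step.
  have szE : size s = (index x s).+1 by apply/eqP; rewrite eqn_leq ge li.
  have lastE : last v s = x by rewrite (last_nth v) szE /= xE.
  (* No edge leaves the last vertex: a target outside [s] would extend [s], the head of [s] would
     close a cycle, and any other vertex of [s] would get a second predecessor. *)
  exfalso; have [ys|ys] := boolP (y \in s); last first.
    have : (size (rcons s y) <= size s)%N.
      apply: mx; rewrite ?rcons_uniq ?ys ?mem_rcons ?inE ?vs ?orbT //.
      case: s ss lastE {us vs step xs li xE ge szE ys} => //= z s ss lE.
      by rewrite rcons_path ss /e lE.
    by rewrite size_rcons ltnn.
  have yE : nth v s (index y s) = y by rewrite nth_index.
  have lj : (index y s < size s)%N by rewrite index_mem.
  case: (index y s) yE lj => [|j] yE lj.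
    have s0 : s != [::] by case: (s) vs.
    case/negP: (acyc s s0 us).
    case: s ss lastE yE {us vs mx step xs li xE ge szE ys lj s0} => //= z s ss lE zE.
    by rewrite rcons_path; apply/andP; split=> //=; rewrite lE zE.
  have jx : nth v s j = nth v s (index x s).
    by rewrite xE; apply: (inA y) => //; rewrite -[in (_, y)]yE step.
  move/eqP: jx; rewrite nth_uniq //; last exact: ltnW.
  by move=> /eqP jE; move: lj; rewrite jE szE ltnn.
(* Dually, an edge from outside into the head would extend [s], and an edge into a later vertex
   starts at the preceding one. *)
have pred x y : y \in s -> (x, y) \in A -> x \in s.
  move=> ys xy.
  have yE : nth v s (index y s) = y by rewrite nth_index.
  have lj : (index y s < size s)%N by rewrite index_mem.
  case: (index y s) yE lj => [|j] yE lj.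
    case: (boolP (x \in s)) => // xs; have : (size (x :: s) <= size s)%N.
      apply: mx; rewrite /= ?xs ?inE ?vs ?orbT //.
      by case: s ss yE {us vs step succ ys xs lj} => //= z s -> ->; rewrite andbT.
    by rewrite ltnn.
  suff -> : x = nth v s j by rewrite mem_nth // ltnW.
  by apply: (inA y) => //; rewrite -[in (_, y)]yE step.
have succ_in x y : x \in s -> (x, y) \in A -> y \in s.
  move=> xs xy; have /(mem_zip_behead _ v)[i li [_ ->]] := succ x y xs xy.
  exact: mem_nth.
have con i : (i < size s)%N -> connect (uadj A) (nth v s 0) (nth v s i).
  elim: i => [|i IH] li //; apply: connect_trans (IH (ltnW li)) _.
  by apply: connect1; rewrite /uadj step.
have compE w : (w \in component A v) = (w \in s).
  rewrite inE; apply/idP/idP => [vw|ws].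
    case: (boolP (w \in s)) => // nws.
    have [||x [y [xs ys xy]]] := connect_exit _ _ [set x in s] _ _ vw.
    - by rewrite inE.
    - by rewrite inE.
    move: xs ys; rewrite !inE => xs /negP[].
    by case/orP: xy; [apply: succ_in|apply: pred].
  rewrite -(nth_index v vs) -(nth_index v ws).
  apply: (connect_trans _ (con _ _)); last by rewrite index_mem.
  rewrite (sym_connect_sym (uadj_sym _ A)); apply: con; by rewrite index_mem.
apply/hasP; exists s.
  rewrite mem_permutations; apply: uniq_perm => // [|w].
    exact: enum_uniq.
  by rewrite mem_enum compE.
apply/eqP/setP => -[x y]; rewrite inE [RHS]inE compE /=.
apply/andP/idP => [[xy xs]|xy]; first exact: succ.
have /(mem_zip_behead _ v)[i li [-> ->]] := xy.
by rewrite step // mem_nth // ltnW.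
Qed.

(** * Edge classes and multipaths in an MP-tree *)

(* Edges sharing their source or target are dependent in the multipath matroid,
   and so are the two edges of a 2-cycle, which is the only MP-tree that has
   antiparallel edges. *)
Definition related {V : eqType} : rel (V * V) :=
  fun a b => [|| a.1 == b.1, a.2 == b.2 | (a.1 == b.2) && (a.2 == b.1)].

(** Both edges lie in one component, whose vertices [s] lists once each. At positions i and j, a
    common source or target gives i = j, and antiparallel edges would need i = j + 1 and j = i +
    1. *)
Lemma path_component_related (V : finType) (A : {set V * V}) (a b : V * V) :
  path_component A a.1 -> a \in A -> b \in A -> related a b -> a = b.
Proof.
move=> /hasP[s + /eqP edgesE] aA bA rab.
rewrite mem_permutations => /perm_uniq; rewrite enum_uniq => us.
have ab1 : connect (uadj A) a.1 b.1.
  case/or3P: rab => [/eqP->|/eqP eq2|/andP[_ /eqP <-]] //.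
    apply: (connect_trans (y := a.2)); apply: connect1; rewrite /uadj.
      by rewrite -surjective_pairing aA.
    by rewrite eq2 -surjective_pairing bA orbT.
  by apply: connect1; rewrite /uadj -surjective_pairing aA.
have mem c : c \in A -> connect (uadj A) a.1 c.1 -> c \in zip s (behead s).
  by move=> cA acc; have /setP/(_ c) := edgesE; rewrite !inE cA acc.
have /(mem_zip_behead _ a.1)[i li aE] := mem a aA (connect0 _ _).
have /(mem_zip_behead _ a.1)[j lj bE] := mem b bA ab1.
have li' := ltnW li; have lj' := ltnW lj.
move: rab; rewrite aE bE /related /= !nth_uniq // eqSS orbA orbb.
case/orP=> [/eqP->//|/andP[/eqP-> /eqP]] E.
by have := ltnn j; rewrite -[X in (_ < X)%N]E ltnS leqnSn.
Qed.

Lemma tree_no_triangle (V : finType) (u : rel V) (x y z : V) :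
  utree u -> u x y -> u y z -> u z x -> False.
Proof.
move=> [_ irr _ acyc] xy yz zx.
have ne a b : u a b -> a != b by apply: contraTneq => ->; rewrite irr.
suff uxyz : uniq [:: x; y; z].
  by case/negP: (acyc [:: x; y; z] isT uxyz); rewrite /= xy yz zx.
by rewrite /= !inE negb_or (ne _ _ xy) (ne _ _ yz) eq_sym (ne _ _ zx).
Qed.

Lemma uadj_edge (G : digraph) (v w : G) : edge v w -> uadj (edges G) v w.
Proof. by rewrite /uadj !inE /= => ->. Qed.

(** By [MP2] the 2-cycle is a component, and a tree has only one. *)
Lemma MP_tree_bidirected (G : digraph) (v w : G) (a : G * G) :
  MP_tree G -> edge v w -> edge w v -> a \in edges G -> a = (v, w) \/ a = (w, v).
Proof.
move=> [[_ MP2G] [_ irr conn _]] vw wv aE.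
have ne : v != w by apply: contraTneq (uadj_edge _ _ _ vw) => ->; rewrite irr.
have uvw : uniq [:: v; w] by rewrite /= inE ne.
have cvw : cycle (@edge G) [:: v; w] by rewrite /= vw wv.
have [_ /setP/(_ a)] := MP2G [:: v; w] isT uvw cvw v (mem_head _ _).
rewrite inE in aE; rewrite !inE aE conn.
by move=> /esym/orP[]/eqP; [left|right].
Qed.

(** Otherwise [s], [r], [p], [q], in this order, carry a copy of [D_B]. *)
Lemma MP_tree_no_zigzag (G : digraph) (p q r s : G) :
  MP_tree G -> edge p q -> edge p r -> edge s r -> q = r \/ p = s.
Proof.
move=> [[[_ _ noB _] _] tree] pq pr sr; have [_ irr _ _] := tree.
have ne (a b : G) : edge a b -> a != b.
  by move=> ab; apply: contraTneq (uadj_edge _ _ _ ab) => ->; rewrite irr.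
have [->|qr] := eqVneq q r; [by left|have [->|ps] := eqVneq p s; [by right|]].
case: noB; pose t := [:: s; r; p; q]; exists (fun i : 'I_4 => nth s t i).
have ut : uniq t.
  rewrite /= !inE !negb_or (ne _ _ sr) [s == p]eq_sym ps [r == p]eq_sym (ne _ _ pr).
  rewrite [r == q]eq_sym qr (ne _ _ pq) !andbT /=.
  (* The remaining coincidence, [s = q], would make [p], [q], [r] a triangle. *)
  apply/eqP => sq; subst s; apply: (tree_no_triangle _ _ p q r tree).
  - exact: uadj_edge.
  - exact: uadj_edge.
  - by rewrite uadj_sym; apply: uadj_edge.
split=> [i j /eqP|].
  by rewrite nth_uniq // => /eqP/val_inj.
by move=> [[|[|[|[|i]]]] Hi] [[|[|[|[|j]]]] Hj].
Qed.

Lemma related_sym (V : eqType) : symmetric (@related V).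
Proof.
by move=> a b; rewrite /related !(eq_sym b.1) !(eq_sym b.2) [X in [|| _, _ | X]]andbC.
Qed.

(** An antiparallel pair is the whole graph, and its edges are all related. Otherwise the only hard
    case mixes a common source with a common target, which is the zigzag of [MP_tree_no_zigzag]. *)
Lemma related_trans (G : digraph) (a b c : G * G) :
  MP_tree G -> a \in edges G -> b \in edges G -> c \in edges G ->
  related a b -> related b c -> related a c.
Proof.
move=> hG aE bE cE.
case: (boolP ((a.1 == b.2) && (a.2 == b.1))) => [/andP[/eqP ab /eqP ba] _|nab].
  rewrite inE in aE; have /= ba' := bE; rewrite inE -ba -ab in ba'.
  case: (MP_tree_bidirected _ _ _ c hG aE ba' cE) => ->.
    by rewrite /related /= eqxx.
  by rewrite /related /= !eqxx !orbT.
case: (boolP ((b.1 == c.2) && (b.2 == c.1))) => [/andP[/eqP bc /eqP cb] + _|nbc].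
  have bE' := bE; rewrite inE in bE'; have /= cb' := cE; rewrite inE -cb -bc in cb'.
  case: (MP_tree_bidirected _ _ _ a hG bE' cb' aE) => ->.
    by rewrite /related /= bc cb !eqxx !orbT.
  by rewrite /related /= cb eqxx.
rewrite /related (negPf nab) (negPf nbc) !orbF.
move: aE bE cE {nab nbc}; rewrite !inE.
case: a b c => [p q] [p' q'] [p'' q''] /= pq pq' pq''.
case/orP=> /eqP E; subst; case/orP=> /eqP E; subst; rewrite ?eqxx ?orbT //.
  by case: (MP_tree_no_zigzag _ _ _ _ _ hG pq pq' pq'') => ->; rewrite eqxx ?orbT.
by case: (MP_tree_no_zigzag _ _ _ _ _ hG pq'' pq' pq) => ->; rewrite eqxx ?orbT.
Qed.

(** A function whose fibres are the classes is the form in which [tutte_eval_partition] takes a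
    partition. *)
Definition edge_class {G : digraph} (a : G * G) : {set G * G} :=
  [set b in edges G | related a b].

Lemma edge_classP (G : digraph) (a b : G * G) :
  MP_tree G -> a \in edges G -> b \in edges G ->
  edge_class a = edge_class b <-> related a b.
Proof.
move=> hG aE bE; split=> [E|rab].
  have : b \in edge_class a by rewrite E inE bE /related eqxx.
  by rewrite inE => /andP[].
have rba : related b a by rewrite related_sym.
apply/setP => c; rewrite !inE; apply: andb_id2l => cE.
have {}cE : c \in edges G by rewrite inE.
apply/idP/idP => rc; first exact: (related_trans _ b a c).
exact: (related_trans _ a b c).
Qed.

(** Without distinct related edges, [A] has in- and out-degrees at most one and no 2-cycle; the tree
    excludes loops and longer cycles, so [path_component_linear] applies. The converse is
    [path_component_related]. *)
Lemma multipathP (G : digraph) (A : {set G * G}) :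
  MP_tree G ->
  multipath A <-> A \subset edges G /\ {in A &, injective edge_class}.
Proof.
move=> hG; have [_ [_ irr _ acyc]] := hG; split.
  move=> /andP[sA /forallP pc]; split=> // a b aA bA.
  move=> /(edge_classP _ _ _ hG (subsetP sA _ aA) (subsetP sA _ bA)).
  exact: path_component_related (pc a.1) aA bA.
move=> [sA inj]; rewrite /multipath sA; apply/forallP => v.
have rel_eq a b : a \in A -> b \in A -> related a b -> a = b.
  move=> aA bA rab; apply: inj => //.
  by apply/edge_classP => //; apply: (subsetP sA).
apply: path_component_linear.
- move=> x y z xy xz.
  by have [] : (x, y) = (x, z) by apply: rel_eq; rewrite // /related eqxx.
- move=> x y z xy xz.
  by have [] : (y, x) = (z, x) by apply: rel_eq; rewrite // /related eqxx ?orbT.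
have nl x : (x, x) \notin A.
  apply/negP => /(subsetP sA); rewrite inE => /uadj_edge; by rewrite irr.
move=> [|x [|y [|z s]]] // _ us; apply/negP => cyc.
- by move: cyc; rewrite /= (negPf (nl x)).
- have /= /and3P[xy yx _] := cyc.
  have [E _] : (x, y) = (y, x) by apply: rel_eq; rewrite // /related !eqxx ?orbT.
  by move: xy; rewrite E (negPf (nl y)).
case/negP: (acyc [:: x, y, z & s] isT us).
by apply: sub_cycle cyc => a b ab; rewrite /uadj (subsetP sA).
Qed.

(** * Counting flowing colourings *)

(* Picks one direction for every adjacent pair; it differs from [edge] only on
   the 2-cycle. *)
Definition forward {G : digraph} (a : G * G) : bool :=
  edge a.1 a.2 && (edge a.2 a.1 ==> (enum_rank a.1 < enum_rank a.2)%N).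

Lemma forward_swap (G : digraph) (v w : G) :
  irreflexive (uadj (edges G)) -> uadj (edges G) v w ->
  forward (w, v) = ~~ forward (v, w).
Proof.
move=> irr vw.
have ne : v != w by apply: contraTneq vw => ->; rewrite irr.
move: vw; rewrite /uadj /forward !inE /=.
case: (edge v w); case: (edge w v) => //= _.
rewrite -leqNgt ltn_neqAle andb_idl // => _.
by rewrite (inj_eq val_inj) (inj_eq enum_rank_inj) eq_sym.
Qed.

Lemma forward_edge (G : digraph) (a : G * G) : forward a -> a \in edges G.
Proof. by rewrite inE => /andP[]. Qed.

Lemma forward_related (G : digraph) (a b : G * G) :
  irreflexive (uadj (edges G)) -> forward a -> forward b -> related a b ->
  a.1 = b.1 \/ a.2 = b.2.
Proof.
move=> irr fa fb /or3P[/eqP|/eqP|]; [by left|by right|].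
case: a b fa fb => [v w] [v' w'] fa fb /= /andP[/eqP ? /eqP ?]; subst v' w'.
have := forward_edge _ _ fa; rewrite inE => /uadj_edge/(forward_swap _ _ _ irr).
by rewrite fa fb.
Qed.

Lemma flowingP (G : digraph) (k : nat) (c : {ffun G -> 'I_k}) :
  reflect [/\ forall v w : G, edge v w -> c v != c w,
              forall v v' w : G, edge v w -> edge v' w -> c v = c v' &
              forall v v' w : G, edge w v -> edge w v' -> c v = c v']
          (flowing c).
Proof.
apply: (iffP and3P) => [[h1 h2 h3]|[h1 h2 h3]]; split.
- by move=> v w; apply/implyP; move/forallP/(_ v)/forallP/(_ w): h1.
- move=> v v' w vw v'w; apply/eqP.
  by move/forallP/(_ v)/forallP/(_ v')/forallP/(_ w)/implyP: h2; apply; rewrite vw.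
- move=> v v' w vw v'w; apply/eqP.
  by move/forallP/(_ v)/forallP/(_ v')/forallP/(_ w)/implyP: h3; apply; rewrite vw.
- by apply/forallP => v; apply/forallP => w; apply/implyP/h1.
- apply/forallP => v; apply/forallP => v'; apply/forallP => w.
  by apply/implyP => /andP[vw v'w]; apply/eqP/(h2 _ _ w).
- apply/forallP => v; apply/forallP => v'; apply/forallP => w.
  by apply/implyP => /andP[vw v'w]; apply/eqP/(h3 _ _ w).
Qed.

(** The colours ['I_k.+1] form a cyclic group. Related forward edges share an end, and the flowing
    conditions equate the colours at their other ends, so the increment depends only on the
    class. *)
Lemma tau_MP_tree (G : digraph) (k : nat) :
  MP_tree G ->
  tau G k.+1 = (k.+1 * k ^ #|[set edge_class a | a in edges G]|)%N.
Proof.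
move=> hG; have [_ tree] := hG; have [V0 irr conn _] := tree.
have [r _] : exists r : G, r \in G by apply/card_gt0P.
pose P := [set edge_class a | a in edges G].
(* A forward representative fixes the sign of the increment on the 2-cycle. The default [(r, r)] is
   never reached on the class of an edge. *)
pose rep (C : {set G * G}) := odflt (r, r) [pick a in C | forward a].
have repP a : a \in edges G -> forward (rep (edge_class a)) /\
    related a (rep (edge_class a)).
  move=> aE; rewrite /rep; case: pickP => [b /andP[]|/= none].
    by rewrite inE => /andP[].
  have aa : uadj (edges G) a.1 a.2 by rewrite /uadj -surjective_pairing aE.
  have := none a; rewrite inE aE /related eqxx /= => fa.
  have fs : forward (a.2, a.1).
    by rewrite (forward_swap _ _ _ irr aa) -surjective_pairing fa.
  have := none (a.2, a.1).
  by rewrite inE (forward_edge _ _ fs) /related /= !eqxx !orbT fs.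
pose diff (c : {ffun G -> 'I_k.+1}) (a : G * G) := c a.2 - c a.1.
pose Phi (c : {ffun G -> 'I_k.+1}) :=
  (c r, [ffun C => if C \in P then diff c (rep C) else 0]).
have diff_rep c a : flowing c -> forward a -> diff c (rep (edge_class a)) = diff c a.
  move=> /flowingP[_ hin hout] fa; have aE := forward_edge _ _ fa.
  have [fb rab] := repP a aE; have bE := forward_edge _ _ fb.
  move: (rep _) fb rab bE aE => b fb rab; rewrite /diff !inE => bE aE.
  case: (forward_related _ _ _ irr fa fb rab) => E.
    by rewrite -E (hout b.2 a.2 a.1) // E.
  by rewrite -E (hin b.1 a.1 a.2) // E.
pose X := setX [set: 'I_k.+1] [set d : {ffun {set G * G} -> 'I_k.+1} |
  d \in pffun_on 0 (mem P) (predC1 0)].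
(* Injectivity: [Phi c] gives the increments on forward edges, hence up to sign on all adjacent
   pairs, and with the root colour these determine [c]. *)
have -> : tau G k.+1 = #|[set Phi c | c in [set c | flowing c]]|.
  rewrite card_in_imset // => c1 c2; rewrite !inE => fl1 fl2 [er ed].
  apply/ffunP; apply: (potential_unique _ _ (uadj (edges G)) _ _ r) => // v w vw.
  have fwd (x y : G) : forward (x, y) -> c1 y - c1 x = c2 y - c2 x.
    move=> fxy; have := diff_rep _ _ fl1 fxy; rewrite /diff /= => <-.
    have := diff_rep _ _ fl2 fxy; rewrite /diff /= => <-.
    move/ffunP/(_ (edge_class (x, y))): ed.
    by rewrite !ffunE imset_f // forward_edge.
  have [/fwd//|nf] := boolP (forward (v, w)).
  rewrite -opprB -[RHS]opprB; congr (- _); apply: fwd.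
  by rewrite (forward_swap _ _ _ irr vw).
suff -> : [set Phi c | c in [set c | flowing c]] = X.
  rewrite cardsX cardsT card_ord cardsE card_pffun_on cardC1 card_ord.
  by congr (_ * _ ^ _)%N; apply: eq_card.
apply/eqP; rewrite eqEsubset; apply/andP; split; apply/subsetP.
  move=> _ /imsetP[c + ->]; rewrite inE => fl.
  have [neq _ _] := flowingP _ _ _ fl.
  rewrite in_setX in_setT in_set /=; apply/pfamilyP; split.
    by apply/supportP => C nC; rewrite ffunE (negPf nC).
  move=> C CP; rewrite ffunE CP.
  have /imsetP[a aE ->] := CP; have [fb _] := repP a aE.
  rewrite inE /diff subr_eq0 eq_sym; apply: neq.
  by have := forward_edge _ _ fb; rewrite inE.
(* Surjectivity: [d] prescribes antisymmetric increments [g], which [tree_potential] integrates from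
   the value [z] at [r]. *)
move=> [z d]; rewrite in_setX in_setT in_set /= => /pfamilyP[/supportP supp dne].
have d0 a : a \in edges G -> d (edge_class a) != 0.
  by move=> aE; have := dne _ (imset_f _ aE); rewrite inE.
pose g v w := if forward (v, w) then d (edge_class (v, w))
              else - d (edge_class (w, v)).
have ganti v w : uadj (edges G) v w -> g w v = - g v w.
  move=> vw; rewrite /g (forward_swap _ _ _ irr vw).
  by case: (forward (v, w)); rewrite ?opprK.
have [c [cr pot]] :=
  tree_potential _ _ _ g r z (uadj_sym _ _) tree ganti.
have edge_uadj (v w : G) : edge v w -> c w - c v = g v w.
  by move=> vw; apply: pot; apply: uadj_edge.
(* Off the 2-cycle every edge is forward. *)
have sided (v w : G) (a : G * G) : edge v w -> a \in edges G ->
    forward (v, w) \/ a = (v, w) \/ a = (w, v).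
  move=> vw aE; have [wv|nwv] := boolP (edge w v).
    by right; apply: MP_tree_bidirected.
  by left; rewrite /forward /= vw (negPf nwv).
have irr' (v : G) : edge v v = false.
  by apply/negP => /uadj_edge; rewrite irr.
have flc : flowing [ffun v => c v].
  apply/flowingP; split.
  - move=> v w vw; rewrite !ffunE eq_sym -subr_eq0 (edge_uadj _ _ vw) /g.
    case: ifP => [/forward_edge/d0//|nf]; rewrite oppr_eq0; apply/d0/forward_edge.
    by rewrite (forward_swap _ _ _ irr (uadj_edge _ _ _ vw)) nf.
  - move=> v v' w vw v'w; rewrite !ffunE.
    have E1 : (v, w) \in edges G by rewrite inE.
    have E2 : (v', w) \in edges G by rewrite inE.
    (* Either both edges are forward, and lying in one class they have equal increments, or they
       belong to the 2-cycle, where a common target makes them equal. *)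
    have [f1|[[->]|[_ ew]]] := sided v w (v', w) vw E2; first last.
    + by move: vw; rewrite ew irr'.
    + by [].
    have [f2|[[->]|[_ ew]]] := sided v' w (v, w) v'w E1; first last.
    + by move: v'w; rewrite ew irr'.
    + by [].
    have := edge_uadj _ _ vw; have := edge_uadj _ _ v'w.
    rewrite /g f1 f2.
    have -> : edge_class (v', w) = edge_class (v, w).
      by apply/edge_classP; rewrite // /related /= eqxx orbT.
    by move=> <- /addrI/oppr_inj.
  - move=> v v' w vw v'w; rewrite !ffunE.
    have E1 : (w, v) \in edges G by rewrite inE.
    have E2 : (w, v') \in edges G by rewrite inE.
    have [f1|[[->]|[ew _]]] := sided w v (w, v') vw E2; first last.
    + by move: vw; rewrite ew irr'.
    + by [].
    have [f2|[[->]|[ew _]]] := sided w v' (w, v) v'w E1; first last.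
    + by move: v'w; rewrite ew irr'.
    + by [].
    have := edge_uadj _ _ vw; have := edge_uadj _ _ v'w.
    rewrite /g f1 f2.
    have -> : edge_class (w, v') = edge_class (w, v).
      by apply/edge_classP; rewrite // /related /= eqxx.
    by move=> <- /addIr.
apply/imsetP; exists [ffun v => c v]; first by rewrite inE.
rewrite /Phi ffunE cr; congr (_, _); apply/ffunP => C; rewrite ffunE.
case: ifP => [/imsetP[a aE ->]|nC]; last by apply: supp; rewrite /= nC.
have [fb rab] := repP a aE; have bE := forward_edge _ _ fb.
have -> : edge_class a = edge_class (rep (edge_class a)).
  exact/edge_classP.
rewrite (diff_rep _ _ flc fb) /diff !ffunE.
move: (rep _) fb bE => [v w] fb; rewrite inE => vw.
by rewrite (edge_uadj _ _ vw) /g fb.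
Qed.

Theorem theorem5p10 (G : digraph) (k : nat) (hG : MP_tree G) :
  k%:Z * tutte_eval (multipath_matroid G) (1 - k%:Z) 0
  = (-1) ^+ rank (multipath_matroid G) (edges G) * (tau G k)%:Z.
Proof.
have indepM (I : {set G * G}) : I \in indep (multipath_matroid G) <->
    I \subset ground (multipath_matroid G) /\ {in I &, injective edge_class}.
  by rewrite inE; apply: multipathP.
rewrite (tutte_eval_partition _ _ _ _ _ indepM).
rewrite (rank_partition _ _ _ _ _ indepM) //=.
(* Without colours both sides vanish, because a tree has a vertex to colour. *)
case: k => [|k].
  have [_ [/card_gt0P[r _] _ _ _]] := hG.
  rewrite mul0r /tau (_ : [set c | flowing c] = set0) ?cards0 ?mulr0 //.
  by apply/setP => c; case: (c r).
rewrite tau_MP_tree // PoszM mulrCA; congr (_ * _).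
(* The power of [- k] splits into the sign and a power of [k], the exponent being both the rank and
   the number of classes. *)
have -> : 1 - k.+1%:Z = - k%:Z by rewrite intS opprD addrA subrr add0r.
by rewrite -!natz natrX [LHS]exprNn.
Qed.
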